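(* Let $S$ be a numerical semigroup with genus $g(S)$. Then $|S \cap [0,x]| \leq \frac{x}{2} + 1$ for every $x \in \mathbb{N}$ with $x \leq 2g(S) - 2$.
   Context: A numerical semigroup is a subset $S \subseteq \mathbb{N} = \{0,1,2,\ldots\}$ closed under addition, containing $0$, with finite complement. Its genus is $g(S) := |\mathbb{N}\setminus S|$. *)

(* Defs.v *)
From mathcomp Require Import all_boot all_order all_algebra finmap.
From mathcomp Require Import all_classical.

Set Implicit Arguments.
Unset Strict Implicit.
Unset Printing Implicit Defensive.

Local Open Scope classical_set_scope.
Local Open Scope nat_scope.

Definition numerical_semigroup (S : set nat) : Prop :=
  [/\ S 0, (forall a b : nat, S a -> S b -> S (a + b)) & finite_set (~` S)].

(* [fset_set] is the empty set on infinite sets, so this is the number of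
   gaps only when [~` S] is finite, as it is for a numerical semigroup. *)
Definition genus (S : set nat) : nat := #|` fset_set (~` S)|%fset.

(* Main.v *)
(** Reflection [s |-> y - s] sends the elements of [S] below a gap [y] to gaps,
    so [S] contains at most half of [[0, y]].  If some gap exceeds [x], descend
    from it to [x] one step at a time; otherwise every gap lies in [[0, x]],
    so [g = x + 1 - |S ∩ [0, x]|] and the hypothesis on [x] gives the bound. *)
Require Import Defs.
From mathcomp Require Import all_boot all_order all_algebra finmap.
From mathcomp Require Import all_classical.
From mathcomp Require Import zify lra.

Set Implicit Arguments.
Unset Strict Implicit.
Unset Printing Implicit Defensive.

Import Order.TTheory GRing.Theory Num.Theory.
Local Open Scope classical_set_scope.
Local Open Scope ring_scope.

Lemma count_reflect_le (p : pred nat) (y : nat) :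
  (forall a b, p a -> p b -> p (a + b)%N) -> ~~ p y ->
  (2 * count p (iota 0 y.+1) <= y.+1)%N.
Proof.
move=> pD py; rewrite mul2n -addnn -[leqRHS](size_iota 0).
(* Splitting [y.+1] by [p] and its complement leaves [count p <= count (predC p)] on [[0, y]];
   reversing the left sum makes this termwise. *)
rewrite -(count_predC p) leq_add2l.
have -> : iota 0 y.+1 = index_iota 0 y.+1 by rewrite /index_iota subn0.
rewrite -!sum1_count ![(\sum_(_ <- _ | _) 1)%N]big_mkcond big_nat_rev /=.
rewrite !big_mkord; apply: leq_sum => -[i /= ltiy] _; rewrite add0n subSS.
case: ifP => // pyi; rewrite (_ : ~~ p i) //; apply: contra py => pi.
by rewrite -(subnK (ltiy : i <= y)%N); apply: pD.
Qed.

(** Induction on the distance [n] to the gap; the bound is one weaker than at a gap itself, so that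
    it survives each step down. *)
Lemma count_below_gap (p : pred nat) (x n : nat) :
  (forall a b, p a -> p b -> p (a + b)%N) -> ~~ p (x + n)%N ->
  (2 * count p (iota 0 x.+1) <= x.+2)%N.
Proof.
move=> pD; elim: n x => [|n IHn] x; first rewrite addn0.
  by move=> /(count_reflect_le pD)/leqW.
rewrite addnS -addSn => pxn; have := IHn _ pxn.
have := @count_reflect_le p x.+1 pD.
rewrite -[in iota 0 x.+2]addn1 iotaD count_cat /= add0n addn0.
(* If [p x.+1], dropping it lowers the doubled count by 2 and the bound by only 1. Otherwise [x.+1]
   is a gap, and reflecting in it gives [x.+2] directly. *)
by case: (p x.+1) => /= [_|/(_ isT)]; lia.
Qed.

Lemma card_fset_set_filter (A : set nat) (p : pred nat) (n : nat) :
  (forall i, A i <-> (i < n)%N && p i) ->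
  #|` fset_set A|%fset = count p (iota 0 n).
Proof.
(* An explicit finite form of [A] keeps [fset_set] off its default value. *)
move=> AP; have -> : A = [set` [fset i in [seq i <- iota 0 n | p i]]%fset].
  apply/seteqP; split=> i /=.
    by move=> /AP; rewrite !inE mem_filter mem_iota add0n andbC.
  by rewrite !inE mem_filter mem_iota add0n andbC => /AP.
rewrite set_fsetK card_fseq undup_id ?size_filter //.
by rewrite filter_uniq // iota_uniq.
Qed.

Theorem theorem2p8 (S : set nat) (hS : numerical_semigroup S) (x : nat)
    (hx : x%:Z <= 2 * (genus S)%:Z - 2) :
  (#|` fset_set (S `&` `[0%N, x])|%fset)%:R <= x%:R / 2 + 1 :> rat.
Proof.
have [_ SD _] := hS; pose p i := `[< S i >].
have pD a b : p a -> p b -> p (a + b)%N.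
  by move=> /asboolP Sa /asboolP Sb; apply/asboolP/SD.
have -> : #|` fset_set (S `&` `[0%N, x])|%fset = count p (iota 0 x.+1).
  apply: card_fset_set_filter => i; rewrite /= in_itv /= leEnat ltnS.
  by split=> [[/asboolP Si ix]|/andP[ix /asboolP]] //; apply/andP.
suff : (2 * count p (iota 0 x.+1) <= x.+2)%N.
  rewrite -(ler_nat rat) natrM -[x.+2]addn2 natrD; lra.
have [[y xy py]|nogap] := pselect (exists2 y, (x < y)%N & ~~ p y).
  by apply: (@count_below_gap p x (y - x)); rewrite // subnKC // ltnW.
have gE : genus S = count (predC p) (iota 0 x.+1).
  apply: card_fset_set_filter => i /=; split=> [/asboolPn npi|/andP[_ /asboolPn]//].
  rewrite npi andbT ltnS leqNgt; apply/negP => xi.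
  by apply: nogap; exists i.
have := count_predC p (iota 0 x.+1); rewrite size_iota.
(* With [c] the count of [p], [c + g = x + 1] and [x + 2 <= 2g] give even [2c <= x]. *)
by move: hx; rewrite gE; lia.
Qed.
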